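(* Let $n$ be a positive integer and $0<\beta\le 1$. There exists a compact set $S\subseteq\mathbb{R}^n$ such that for every direction $\omega\in S^{n-1}$ there is a line $\ell$ parallel to $\omega$ for which $\ell\cap S$ contains a subset of Hausdorff dimension $\beta$, and such that the Hausdorff dimension of $S$ satisfies $$\dim S\ \le\ \frac{n-1}{2}+\frac{n+1}{2}\,\beta .$$
   Context: $S^{n-1}$ denotes the unit sphere in $\mathbb{R}^n$, and $\dim$ denotes Hausdorff dimension. *)

(* Defs.v *)
From HB Require Import structures.
From mathcomp Require Import all_boot all_order all_algebra.
From mathcomp Require Import all_classical all_reals all_analysis.

Set Implicit Arguments.
Unset Strict Implicit.
Unset Printing Implicit Defensive.

Import Order.TTheory GRing.Theory Num.Theory.
Import numFieldNormedType.Exports.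

Local Open Scope classical_set_scope.
Local Open Scope ring_scope.

(* The norm that the library puts on ['rV[R]_n] is the sup norm, so the
   Euclidean one is defined here; both induce the same topology, so the
   library's [compact] is the usual notion on R^n. *)
Definition enorm (R : realType) (n : nat) (x : 'rV[R]_n) : R :=
  Num.sqrt (\sum_(i < n) x 0 i ^+ 2).

Definition unit_sphere (R : realType) (n : nat) : set 'rV[R]_n :=
  [set w | enorm w = 1].

Definition affine_line (R : realType) (n : nat) (a w : 'rV[R]_n) :
    set 'rV[R]_n :=
  [set a + t *: w | t in [set: R]].

(* Supremum in [\bar R]: it is [-oo] on [set0] and [+oo] on unbounded sets. *)
Definition diam (R : realType) (n : nat) (A : set 'rV[R]_n) : \bar R :=
  ereal_sup [set (enorm (x - y))%:E | x in A & y in A].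

(* [diam A ^ s], with the convention that the empty set contributes 0 for
   every s, while nonempty sets contribute 1 for s = 0 (so that the measure of
   dimension 0 is counting measure). *)
Definition diam_pow (R : realType) (n : nat) (s : R) (A : set 'rV[R]_n) :
    \bar R :=
  if A == set0 then 0%E else (diam A `^ s)%E.

Definition hausdorff_premeasure (R : realType) (n : nat) (s delta : R)
    (A : set 'rV[R]_n) : \bar R :=
  ereal_inf [set (\sum_(0 <= k <oo) diam_pow s (U k))%E |
    U in [set U : nat -> set 'rV[R]_n |
            A `<=` \bigcup_k U k /\ forall k, (diam (U k) <= delta%:E)%E]].

Definition hausdorff_measure (R : realType) (n : nat) (s : R)
    (A : set 'rV[R]_n) : \bar R :=
  ereal_sup [set hausdorff_premeasure s delta A |
    delta in [set delta : R | 0 < delta]].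

Definition hausdorff_dim (R : realType) (n : nat) (A : set 'rV[R]_n) :
    \bar R :=
  ereal_inf [set s%:E |
    s in [set s : R | 0 <= s /\ hausdorff_measure s A = 0%E]].

(* Main.v *)
Require Import Defs.
From mathcomp Require Import all_boot all_order all_algebra.
From mathcomp Require Import all_classical all_reals all_analysis.
From mathcomp Require Import ring lra zify.
Import Order.TTheory GRing.Theory Num.Theory.
Import numFieldNormedType.Exports.
Local Open Scope classical_set_scope.
Local Open Scope ring_scope.

Set Implicit Arguments.
Unset Strict Implicit.
Unset Printing Implicit Defensive.

(** Write n = n' + 1.  A line whose direction is, up to scaling, (1, d) with
all |d_l| <= 1 is s |-> (s, b + s d), and the construction chooses the
intercept b as a function of d so that, for every j, the part of the line over
a fixed set of parameters s lies near a finite set P_j of points; the set P_j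
does not depend on d.

One scale.  Fix integers k, A, put B = k A, and take the nodes
s_i = 1 / (1 + i/k - theta), i <= k.  If d = u/B + theta v/A with u, v integer
vectors, the line with intercept b = v/A satisfies
   b + s_i d = s_i (u/B + (1 + i/k) v/A) = s_i g/B   with g an integer vector,
because (1 + i/k) v/A is a multiple of 1/(k A).  Thus over the k + 1 nodes all
these lines meet only O(k B^n') points.  With theta of order 1/B the numbers
u/B + theta v/A are 1/(A B)-dense, so every d is reached up to an error
delta = 1/D once k A^2 exceeds a suitable multiple of D.  Taking k = D^beta
and A about D^((1 - beta)/2) gives O(D^(beta + n' (1 + beta)/2)) points, and
this exponent is n'/2 + (n' + 2) beta/2, the asserted bound.  This is Elekes' extremal
configuration for point-line incidences, moved by a projective map that makes
the directions of the lines distinct.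

All scales.  The scales D_0 << D_1 << ... grow so fast that all constants
coming from the levels before j are at most D_j^o(1).  At level j the multiple
of 1/A_j is chosen within 1/E_j of the preceding one, with 1/E_j at most
1/(2 D_(j-1)), so that these approximations converge to a single intercept b
that is good at every level ([intercept], [line_near_grid]).  The compact set
is the intersection over j of the 4/D_j-neighbourhoods of the point sets P_j,
united over the n possible choices of the dominant coordinate of the direction
([furstenberg_set]).  Counting boxes gives the upper bound on its dimension
([furstenberg_set_dim]).

On each line, the points whose parameter s is within 1/D_j of a level-j node
for every j form a Lipschitz graph over a Cantor set [node_cantor], covered at
level j by k_j + 1 intervals of length 2/D_j; hence the dimension is at most
beta.  For the lower bound, let sets of diameters r_k cover the Cantor set and,
for 0 < t < beta, weigh them by min(1, (24 r_k D_j)^t).  If the sets meeting a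
level-j interval have total weight less than 1, then so do, at level j + 1, the
sets meeting one of its children, by averaging over the well-separated
children.  A total weight less than 1 at the start would thus yield a point of
the Cantor set that no set of the cover contains ([cantor_gauge_cover],
[gauge_step], [node_cantor_cover]). *)

(** * Nested intervals and covers of Cantor sets *)

Lemma nested_intervals (R : realType) (x d : nat -> R) :
  (forall j, 0 <= d j) -> (forall j, `|x j.+1 - x j| <= d j - d j.+1) ->
  exists s, forall j, `|s - x j| <= d j.
Proof.
move=> d0 xd.
have mono i j : x i - d i <= x (j + i)%N - d (j + i)%N /\
                x (j + i)%N + d (j + i)%N <= x i + d i.
  elim: j => [|j [IH1 IH2]]; first by rewrite add0n.
  by move: (xd (j + i)%N); rewrite addSn ler_norml => /andP[h1 h2]; split; lra.
have low i j : x i - d i <= x j + d j.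
  have [[h1 h2] [h3 h4]] := (mono i j, mono j i).
  have := d0 (j + i)%N; rewrite addnC in h3 h4 *; lra.
pose E := [set x i - d i | i in [set: nat]].
have E0 : E !=set0 by exists (x 0%N - d 0%N); exists 0%N.
have ubE j : ubound E (x j + d j) by move=> _ [i _ <-]; exact: low.
exists (sup E) => j; rewrite ler_norml; apply/andP; split.
  have : x j - d j <= sup E by apply: ub_le_sup; [exists (x 0%N + d 0%N)|exists j].
  lra.
by rewrite lerBlDl; apply: ge_sup => //; exact: ubE.
Qed.

(** Ordinals whose multiples of g lie pairwise within X of each other are
contained in a window of length X/g. *)
Lemma card_separated (R : realType) (K : nat) (P : pred 'I_K) (g X : R) :
  0 < g -> 0 <= X ->
  (forall l l', P l -> P l' -> (l < l')%N -> (l' - l)%:R * g <= X) ->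
  (#|P|%:R : R) <= 1 + X / g.
Proof.
move=> g0 X0 h.
have [/eqP ->|] := boolP (#|P| == 0%N).
  by rewrite addr_ge0// divr_ge0// ltW.
rewrite -lt0n => /card_gt0P[x0 Px0].
have [m Pm mmin] := @arg_minnP _ x0 P (fun i => val i) Px0.
have [M PM Mmax] := @arg_maxnP _ x0 P (fun i => val i) Px0.
have mM : (m <= M)%N := mmin _ PM.
have cP : (#|P| <= M - m + 1)%N.
  rewrite cardE -(size_map val) -(size_iota m (M - m + 1)).
  apply: uniq_leq_size; first by rewrite map_inj_uniq ?enum_uniq//; exact: val_inj.
  move=> y /mapP[i]; rewrite mem_enum => Pi ->.
  rewrite mem_iota; apply/andP; split; first exact: mmin.
  by have := Mmax _ Pi; rewrite /=; lia.
apply: (@le_trans _ _ ((M - m + 1)%N%:R)); first by rewrite ler_nat.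
rewrite natrD addrC lerD2l ler_pdivlMr//.
have [mM'|] := ltnP m M; first exact: h.
by rewrite -subn_eq0 => /eqP ->; rewrite mul0r.
Qed.

(** A mass distribution principle in which no measure is built.  [C j] is a set
of admissible centres of level-j intervals, of radius [d j]; each of them has
[K j] children, pairwise [g j]-separated.  A set of diameter at most s meets at
most 1 + (s + 2 d_(j+1)) / g_j children, so the inequality required of the
gauges [phi j] says that passing from an interval to its children does not
increase the average weight of the sets that meet it. *)
Lemma cantor_gauge_cover (R : realType) (C : nat -> set R) (d g : nat -> R)
    (K : nat -> nat) (phi : nat -> R -> R) (F : nat -> set R) (r : nat -> R)
    (x0 : R) :
  C 0%N x0 -> (forall j, 0 <= d j) -> (forall j, 0 < g j) ->
  (forall j, (0 < K j)%N) ->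
  (forall j x, C j x -> exists y : nat -> R,
    (forall l, (l < K j)%N -> C j.+1 (y l) /\ `|y l - x| <= d j - d j.+1) /\
    (forall l l', (l < l')%N -> (l' < K j)%N ->
       (l' - l)%:R * g j <= `|y l' - y l|)) ->
  (forall j s, 0 <= phi j s) ->
  (forall j s, 0 < s -> phi j s < 1 ->
    (1 + (s + 2 * d j.+1) / g j) * phi j.+1 s <= (K j)%:R * phi j s) ->
  (forall s, 0 < s -> exists j, 1 <= phi j s) ->
  (forall k, 0 < r k) ->
  (forall k a b, F k a -> F k b -> `|a - b| <= r k) ->
  (forall s, (forall j, exists2 x, C j x & `|s - x| <= d j) ->
     exists k, F k s) ->
  (1 <= \sum_(0 <= k <oo) (phi 0%N (r k))%:E)%E.
Proof.
move=> Cx0 d0 g0 K0 child phi0 hphi phi1 r0 hF cov.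
pose meets j x k := `[< exists2 a, F k a & `|a - x| <= d j >].
pose w j x k : \bar R := if meets j x k then (phi j (r k))%:E else 0%E.
have w0 j x k : (0 <= w j x k)%E by rewrite /w; case: ifP => //; rewrite lee_fin.
have wle j x k : (w j x k <= \sum_(0 <= i <oo) w j x i)%E.
  apply: le_trans (@nneseries_lim_ge _ _ xpredT 0%N k.+1 _); last by [].
  by rewrite big_mkord big_ord_recr/= leeDr// sume_ge0.
rewrite leNgt; apply/negP => small.
have start : (\sum_(0 <= k <oo) w 0%N x0 k < 1)%E.
  apply: le_lt_trans small; apply: lee_nneseries => // k _.
  by rewrite /w; case: ifP => // _; rewrite lee_fin.
(* An interval of weight less than 1 has a child of weight less than 1:
   otherwise the K j children would have total weight at least K j. *)
have step j x : C j x -> (\sum_(0 <= k <oo) w j x k < 1)%E ->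
    exists y, [/\ C j.+1 y, (\sum_(0 <= k <oo) w j.+1 y k < 1)%E &
      `|y - x| <= d j - d j.+1].
  move=> Cx wx; have [y [yC ysep]] := child _ _ Cx.
  apply: contrapT => /forallNP no.
  have big l : (l < K j)%N -> (1 <= \sum_(0 <= k <oo) w j.+1 (y l) k)%E.
    move=> lK; rewrite leNgt; apply/negP => lt1; apply: (no (y l)).
    by have [] := yC _ lK.
  have : ((K j)%:R%:E <= (K j)%:R%:E * \sum_(0 <= k <oo) w j x k)%E.
    rewrite -nneseriesZl//.
    apply: (@le_trans _ _ (\sum_(l < K j) \sum_(0 <= k <oo) w j.+1 (y l) k)%E).
      rewrite -[X in (X%:R)%:E]card_ord -sum1_card natr_sum -sumEFin.
      by apply: lee_sum => l _; exact: big.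
    rewrite -nneseries_sum; last by move=> *; exact: w0.
    apply: lee_nneseries => [k _ _|k _]; first exact: sume_ge0.
    pose P := [pred l : 'I_(K j) | meets j.+1 (y l) k].
    have -> : (\sum_(l < K j) w j.+1 (y l) k = (#|P|%:R * phi j.+1 (r k))%:E)%E.
      rewrite /w -big_mkcond/= sumEFin; congr (_%:E).
      by rewrite sumr_const mulr_natl.
    have [/eqP ->|] := boolP (#|P| == 0%N).
      by rewrite mul0r mule_ge0// lee_fin.
    rewrite -lt0n => /card_gt0P[l /asboolP[a Fa al]].
    have mx : meets j x k.
      apply/asboolP; exists a => //.
      have [_ yx] := yC _ (ltn_ord l).
      by have := ler_distD (y l) a x; lra.
    (* The weight of a single set that meets the parent is below 1 too, so the
       inequality on the gauges applies to it. *)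
    have lt1 : phi j (r k) < 1.
      rewrite -lte_fin; apply: le_lt_trans wx.
      by have := wle j x k; rewrite {1}/w mx.
    rewrite /w mx -EFinM lee_fin; apply: le_trans (hphi _ _ (r0 k) lt1).
    apply: ler_wpM2r => //; apply: card_separated => //.
      by have := d0 j.+1; have := r0 k; lra.
    move=> l1 l2 /asboolP[a1 F1 h1] /asboolP[a2 F2 h2] l12.
    apply: le_trans (ysep _ _ l12 (ltn_ord _)) _.
    have := hF _ _ _ F2 F1; have := ler_distD a2 (y l2) (y l1).
    by have := ler_distD a1 a2 (y l1); rewrite (distrC (y l2) a2); lra.
  apply/negP; rewrite -ltNge.
  rewrite -[X in (_ < X)%E]mule1; rewrite lte_pmul2l//.
by rewrite lte_fin ltr0n.
pose st j := {x : R | C j x /\ (\sum_(0 <= k <oo) w j x k < 1)%E}.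
have nxt j (x : st j) : {y : st j.+1 | `|sval y - sval x| <= d j - d j.+1}.
  case: x => x [Cx wx]; have [y [Cy wy yx]] := cid (step _ _ Cx wx).
  by exists (exist _ y (conj Cy wy)).
pose X := fix X j : st j := if j is i.+1 then sval (nxt i (X i))
                            else exist _ x0 (conj Cx0 start).
have Xs j : `|sval (X j.+1) - sval (X j)| <= d j - d j.+1.
  exact: (svalP (nxt j (X j))).
have [s hs] := nested_intervals d0 Xs.
have [|k Fk] := cov s.
  by move=> j; exists (sval (X j)) => //; have [] := svalP (X j).
have [j hj] := phi1 _ (r0 k).
have [_] := svalP (X j); apply/negP; rewrite -leNgt.
apply: le_trans (wle j (sval (X j)) k); rewrite /w ifT ?lee_fin//.
by apply/asboolP; exists s.
Qed.

(** * Bounds on the Hausdorff dimension *)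

Lemma enorm0 (R : realType) n : enorm (0 : 'rV[R]_n) = 0.
Proof. by rewrite /enorm big1 ?sqrtr0// => i _; rewrite mxE expr0n. Qed.

Lemma diam_le (R : realType) n (A : set 'rV[R]_n) (q : R) :
  (forall x y, A x -> A y -> enorm (x - y) <= q) -> (diam A <= q%:E)%E.
Proof.
by move=> h; apply: ge_ereal_sup => _ [x Ax [y Ay <-]]; rewrite lee_fin h.
Qed.

Lemma diam_ge (R : realType) n (A : set 'rV[R]_n) x y :
  A x -> A y -> ((enorm (x - y))%:E <= diam A)%E.
Proof. by move=> Ax Ay; apply: ereal_sup_ubound; exists x => //; exists y. Qed.

Lemma diam_ge0 (R : realType) n (A : set 'rV[R]_n) :
  A !=set0 -> (0 <= diam A)%E.
Proof.
by move=> [x Ax]; have := diam_ge Ax Ax; rewrite subrr enorm0.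
Qed.

Lemma diam_pow_ge0 (R : realType) n (s : R) (A : set 'rV[R]_n) :
  (0 <= diam_pow s A)%E.
Proof. by rewrite /diam_pow; case: ifP => // _; exact: poweR_ge0. Qed.

Lemma diam_pow_le (R : realType) n (s q : R) (A : set 'rV[R]_n) :
  0 <= s -> (diam A <= q%:E)%E -> (diam_pow s A <= (q `^ s)%:E)%E.
Proof.
move=> s0 Aq; rewrite /diam_pow; case: ifPn => [_|/set0P A0].
  by rewrite lee_fin powR_ge0.
have dA := diam_ge0 A0.
rewrite -poweR_EFin; apply: gt0_ler_poweR => //; rewrite in_itv/= leey andbT//.
exact: le_trans Aq.
Qed.

Lemma hausdorff_premeasure_ge0 (R : realType) n (s d : R) (A : set 'rV[R]_n) :
  (0 <= hausdorff_premeasure s d A)%E.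
Proof.
apply: le_ereal_inf_tmp => _ [U _ <-]; apply: nneseries_ge0 => k _ _.
exact: diam_pow_ge0.
Qed.

(** It suffices to have, for each t > sigma, finite covers by sets of diameter
at most q for which q and N q^t are arbitrarily small, N being the number of
sets. *)
Lemma hausdorff_dim_le (R : realType) n (A : set 'rV[R]_n) (sigma : R) :
  0 <= sigma ->
  (forall t e, sigma < t -> 0 < e ->
    exists (I : finType) (U : I -> set 'rV[R]_n) (q : R),
      [/\ q <= e, forall i x y, U i x -> U i y -> enorm (x - y) <= q,
          A `<=` [set x | exists i, U i x] & #|I|%:R * q `^ t <= e]) ->
  (hausdorff_dim A <= sigma%:E)%E.
Proof.
move=> s0 cov; apply/lee_addgt0Pr => eta eta0; rewrite -EFinD.
set t := sigma + eta; have st : sigma < t by rewrite /t; lra.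
have t0 : 0 <= t by lra.
apply: ge_ereal_inf; exists t%:E => //; exists t => //; split => //.
apply/eqP; rewrite eq_le; apply/andP; split; last first.
  apply: le_trans (hausdorff_premeasure_ge0 t 1 A) _.
  by apply: ereal_sup_ubound; exists 1 => //=.
apply: ge_ereal_sup => _ [d /= d0 <-].
apply/lee_addgt0Pr => e e0; rewrite add0e.
have m0 : 0 < Num.min d e by rewrite lt_min d0 e0.
have [I [U [q [qe Uq AU Nq]]]] := cov _ _ st m0.
pose V k := if @insub _ _ 'I_#|I| k is Some i then U (enum_val i) else set0.
have Vq k : (diam (V k) <= q%:E)%E.
  by apply: diam_le; rewrite /V; case: insub => // i x y; exact: Uq.
apply: ge_ereal_inf; exists (\sum_(0 <= k <oo) diam_pow t (V k))%E.
  exists V => //; split.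
    move=> x /AU[i Ui]; exists (val (enum_rank i)) => //.
    by rewrite /V valK enum_rankK.
  by move=> k; apply: le_trans (Vq k) _; rewrite lee_fin (le_trans qe)// ge_min lexx.
rewrite (nneseries_split 0 #|I|); last by move=> *; exact: diam_pow_ge0.
rewrite [X in (_ + X)%E]eseries0 ?adde0.
  apply: (@le_trans _ _ (\sum_(0 <= k < 0 + #|I|) (q `^ t)%:E)%E).
    by apply: lee_sum => k _; exact: diam_pow_le.
  rewrite sumEFin lee_fin big_mkord sumr_const card_ord -mulr_natl.
  by apply: le_trans Nq _; rewrite ge_min lexx orbT.
move=> k; rewrite add0n => Nk _; rewrite /V insubN -?leqNgt//.
by rewrite /diam_pow eqxx.
Qed.

(** The diameters of a cover are replaced by strictly positive upper bounds
[r k], so that singletons need no separate treatment afterwards. *)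
Lemma hausdorff_dim_ge (R : realType) n (A : set 'rV[R]_n) (sigma : R) :
  (forall t, 0 < t -> t < sigma -> exists2 eta, 0 < eta &
    forall (F : nat -> set 'rV[R]_n) (r : nat -> R),
      (forall k, 0 < r k) ->
      (forall k x y, F k x -> F k y -> enorm (x - y) <= r k) ->
      A `<=` \bigcup_k F k ->
      (eta%:E <= \sum_(0 <= k <oo) (r k `^ t)%:E)%E) ->
  (sigma%:E <= hausdorff_dim A)%E.
Proof.
move=> h; apply: le_ereal_inf_tmp => _ [s [s0 Hs] <-].
rewrite lee_fin leNgt; apply/negP => ss.
(* Going from s to a larger exponent t makes t > 0, so that the diameters can be
   increased by a summable amount; as they are at most 1, the sum of the t-th
   powers is still at most that of the s-th powers. *)
pose t := (s + sigma) / 2.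
have [t0 ts st] : [/\ 0 < t, t < sigma & s < t] by rewrite /t; split; lra.
have [eta eta0 heta] := h _ t0 ts.
have : (hausdorff_premeasure s 1 A < (eta / 3)%:E)%E.
  apply: (@le_lt_trans _ _ 0%E); last by rewrite lte_fin divr_gt0.
  by rewrite -Hs; apply: ereal_sup_ubound; exists 1 => //=.
move=> /ereal_inf_lt[_ [U [AU U1] <-] Usmall].
pose rho k := (eta / 3 / (2 ^ k.+1)%:R) `^ (t^-1).
have rho0 k : 0 < rho k.
  by rewrite powR_gt0// divr_gt0// ?divr_gt0// ltr0n expn_gt0.
pose r k := Num.max (fine (diam (U k))) (rho k).
have r0 k : 0 < r k by rewrite lt_max rho0 orbT.
have Ur k x y : U k x -> U k y -> enorm (x - y) <= r k.
  move=> Ux Uy; rewrite le_max; apply/orP; left.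
  have := diam_ge Ux Uy; have := U1 k.
  by case: (diam (U k)) => //= a _; rewrite lee_fin.
have := heta _ _ r0 Ur AU; apply/negP; rewrite -ltNge.
have e3 : 0 <= eta / 3 by lra.
apply: (@le_lt_trans _ _ ((eta / 3)%:E + (eta / 3)%:E)%E); last first.
  by rewrite -EFinD lte_fin; lra.
apply: (@le_trans _ _
   (\sum_(0 <= k <oo) diam_pow s (U k) + (eta / 3)%:E)%E); last first.
  by rewrite leeD2r// ltW.
apply: le_trans (epsilon_trick xpredT _ e3); last first.
  by move=> k; exact: diam_pow_ge0.
apply: lee_nneseries => [k _ _|k _]; first by rewrite lee_fin powR_ge0.
have rt : rho k `^ t = eta / 3 / (2 ^ k.+1)%:R.
  by rewrite -powRrM mulVf ?gt_eqF// powRr1// divr_ge0.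
rewrite /r maxEle; case: ifPn => [_|].
  by rewrite rt leeDr// diam_pow_ge0.
rewrite -ltNge => lt.
have Uk0 : U k !=set0.
  apply/set0P/eqP => U0; move: lt; rewrite U0 /diam.
  have -> : [set (enorm (x - y))%:E | x in (set0 : set 'rV[R]_n) & y in set0] = set0.
    by apply/seteqP; split => // z [x []].
  by rewrite ereal_sup0/= ltNge ltW.
apply: (@le_trans _ _ (diam_pow s (U k))); last first.
  by rewrite leeDl// lee_fin divr_ge0.
have := U1 k; have := diam_ge0 Uk0; rewrite /diam_pow ifF; last exact/negbTE/set0P.
move: lt; case: (diam (U k)) => //= a ra; rewrite !lee_fin => a0 a1.
apply: ger_powR; last exact: ltW.
by rewrite a1 (lt_trans (rho0 k)).
Qed.

(** * The sequence of scales *)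

(** The integers and reals attached to level j are functions of a natural
number L that encodes the preceding levels: k = (80 L)^(j+1), D = k^(1/beta),
and A is L times an integer of order D^((1 - beta)/2).  The exponent j + 1 makes
every fixed power of L smaller than any given positive power of D when j is
large. *)
Definition scale_k (L j : nat) : nat := ((80 * L) ^ j.+1)%N.

Definition scale_D (R : realType) (beta : R) (k : nat) : R :=
  k%:R `^ beta^-1.

Definition scale_A (R : realType) (beta : R) (L : nat) (D : R) : nat :=
  (L * (Num.truncn (D `^ ((1 - beta) / 2))).+1)%N.

(** The pair (L_j, E_j): E_(j+1) is an integer larger than 2 D_j, and
L_(j+1) = A_j E_(j+1), so that A_j and E_(j+1) both divide A_(j+1). *)
Fixpoint scale_LE (R : realType) (beta : R) (j : nat) : nat * nat :=
  if j is i.+1 then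
    let L := (scale_LE beta i).1 in
    let D := scale_D beta (scale_k L i) in
    let E := (Num.truncn (2 * D)).+1 in
    ((scale_A beta L D * E)%N, E)
  else (2%N, 2%N).

Definition sL (R : realType) (beta : R) j := (scale_LE beta j).1.

(** 1 / E_j bounds the change of the intercept at level j. *)
Definition sE (R : realType) (beta : R) j := (scale_LE beta j).2.

(** The number k_j of steps between the nodes of level j. *)
Definition sk (R : realType) (beta : R) j := scale_k (sL beta j) j.

(** The inverse D_j of the resolution at level j. *)
Definition sD (R : realType) (beta : R) j := scale_D beta (sk beta j).

(** The denominators A_j of the intercepts and B_j = k_j A_j of the grid. *)
Definition sA (R : realType) (beta : R) j := scale_A beta (sL beta j) (sD beta j).
Definition sB (R : realType) (beta : R) j := (sk beta j * sA beta j)%N.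

(** The shear theta_j: slopes are approximated by u / B_j + theta_j v / A_j. *)
Definition stheta (R : realType) (beta : R) j : R :=
  (sE beta j)%:R / (sB beta j)%:R.

Definition sdelta (R : realType) (beta : R) j : R := (sD beta j)^-1.

Lemma sLS (R : realType) (beta : R) j :
  sL beta j.+1 = (sA beta j * sE beta j.+1)%N.
Proof. by []. Qed.

Lemma sE_gt0 (R : realType) (beta : R) j : (0 < sE beta j)%N.
Proof. by case: j. Qed.

Lemma sE_ge (R : realType) (beta : R) j : 2 * sD beta j <= (sE beta j.+1)%:R.
Proof. exact/ltW/truncnS_gt. Qed.


Lemma sD_ge1_of_sL (R : realType) (beta : R) j :
  0 < beta -> (0 < sL beta j)%N -> 1 <= sD beta j.
Proof.
move=> b0 L0; rewrite /sD /scale_D.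
have k1 : 1 <= (sk beta j)%:R :> R.
  by rewrite ler1n expn_gt0 muln_gt0 L0.
by rewrite -[leLHS](powRr0 (sk beta j)%:R); apply: ler_powR => //; rewrite invr_ge0 ltW.
Qed.

Lemma sL_gt (R : realType) (beta : R) j : 0 < beta -> (j.+1 < sL beta j)%N.
Proof.
move=> b0; elim: j => [//|j IH]; rewrite sLS.
have : (sL beta j <= sA beta j)%N by exact: leq_pmulr.
suff : (1 < sE beta j.+1)%N by nia.
rewrite -(ltr_nat R); apply: lt_le_trans (sE_ge beta j).
by have := sD_ge1_of_sL b0 (leq_ltn_trans (leq0n _) IH); lra.
Qed.

Lemma sL_gt1 (R : realType) (beta : R) j : 0 < beta -> (1 < sL beta j)%N.
Proof. by move=> b0; apply: leq_trans (sL_gt j b0). Qed.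

Lemma sD_ge1 (R : realType) (beta : R) j : 0 < beta -> 1 <= sD beta j.
Proof. by move=> b0; rewrite sD_ge1_of_sL// ltnW// sL_gt1. Qed.

Lemma sL_le_sA (R : realType) (beta : R) j : (sL beta j <= sA beta j)%N.
Proof. exact: leq_pmulr. Qed.

Lemma sA_gt0 (R : realType) (beta : R) j : 0 < beta -> (0 < sA beta j)%N.
Proof. by move=> b0; rewrite (leq_trans _ (sL_le_sA beta j))// ltnW// sL_gt1. Qed.

Lemma sE_dvd_sL (R : realType) (beta : R) j : (sE beta j %| sL beta j)%N.
Proof. by case: j => [//|j]; rewrite sLS dvdn_mull. Qed.

Lemma sL_dvd_sA (R : realType) (beta : R) j : (sL beta j %| sA beta j)%N.
Proof. exact: dvdn_mulr. Qed.

Lemma sE_le_sL (R : realType) (beta : R) j : 0 < beta ->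
  (sE beta j <= sL beta j)%N.
Proof. by move=> b0; rewrite dvdn_leq ?sE_dvd_sL// ltnW// sL_gt1. Qed.

Lemma sk_ge (R : realType) (beta : R) j : 0 < beta ->
  (80 * sL beta j <= sk beta j)%N.
Proof.
move=> b0; rewrite /sk /scale_k expnS leq_pmulr// expn_gt0 muln_gt0.
by rewrite (ltnW (sL_gt1 j b0)).
Qed.

Lemma sk_gt0 (R : realType) (beta : R) j : 0 < beta -> (0 < sk beta j)%N.
Proof. by move=> b0; have := sk_ge j b0; have := sL_gt1 j b0; lia. Qed.

Lemma sB_gt0 (R : realType) (beta : R) j : 0 < beta -> (0 < sB beta j)%N.
Proof. by move=> b0; rewrite muln_gt0 sk_gt0// sA_gt0. Qed.

Lemma sk_le_sD (R : realType) (beta : R) j : 0 < beta -> beta <= 1 ->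
  (sk beta j)%:R <= sD beta j.
Proof.
move=> b0 b1; apply: le1r_powR; first by rewrite ler1n sk_gt0.
by rewrite invf_ge1.
Qed.

Lemma sD_pow (R : realType) (beta : R) j : 0 < beta ->
  sD beta j `^ beta = (sk beta j)%:R.
Proof.
by move=> b0; rewrite /sD /scale_D -powRrM mulVf ?gt_eqF// powRr1.
Qed.

Lemma sD_gt0 (R : realType) (beta : R) j : 0 < beta -> 0 < sD beta j.
Proof. by move=> b0; apply: lt_le_trans (sD_ge1 j b0). Qed.

Lemma sdelta_gt0 (R : realType) (beta : R) j : 0 < beta -> 0 < sdelta beta j.
Proof. by move=> b0; rewrite invr_gt0 sD_gt0. Qed.

Lemma sdelta_le1 (R : realType) (beta : R) j : 0 < beta -> sdelta beta j <= 1.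
Proof. by move=> b0; rewrite invf_le1 ?sD_ge1// sD_gt0. Qed.

Lemma sD_le_sLS (R : realType) (beta : R) j : 0 < beta ->
  2 * sD beta j <= (sL beta j.+1)%:R.
Proof.
move=> b0; apply: le_trans (sE_ge beta j) _.
by rewrite ler_nat sE_le_sL.
Qed.

Lemma sD_le_skS (R : realType) (beta : R) j : 0 < beta ->
  160 * sD beta j <= (sk beta j.+1)%:R.
Proof.
move=> b0; have := sD_le_sLS j b0; have := sk_ge j.+1 b0.
by rewrite -(ler_nat R) natrM; lra.
Qed.

Lemma sdeltaS (R : realType) (beta : R) j : 0 < beta -> beta <= 1 ->
  160 * sdelta beta j.+1 <= sdelta beta j.
Proof.
move=> b0 b1; have D0 := sD_gt0 j b0; have D1 := sD_gt0 j.+1 b0.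
have := le_trans (sD_le_skS j b0) (sk_le_sD j.+1 b0 b1) => h.
by rewrite /sdelta ler_pdivrMr// mulrC ler_pdivlMr.
Qed.

Lemma sA_ge (R : realType) (beta : R) j :
  (sL beta j)%:R * sD beta j `^ ((1 - beta) / 2) <= (sA beta j)%:R.
Proof. by rewrite /sA /scale_A natrM ler_wpM2l// ltW// truncnS_gt. Qed.

Lemma sA_le (R : realType) (beta : R) j : 0 < beta -> beta <= 1 ->
  (sA beta j)%:R <= (sL beta j)%:R * (2 * sD beta j `^ ((1 - beta) / 2)).
Proof.
move=> b0 b1; rewrite /sA /scale_A natrM ler_wpM2l//.
set x := _ `^ _.
have x1 : 1 <= x.
  rewrite -[leLHS](powRr0 (sD beta j)); apply: ler_powR; first exact: sD_ge1.
  by rewrite divr_ge0// subr_ge0.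
have : (Num.truncn x)%:R <= x by rewrite truncn_le (le_trans _ x1).
by rewrite -natr1; lra.
Qed.

Lemma powR_half_sqr (R : realType) (a x : R) : 0 <= a ->
  (a `^ (x / 2)) ^+ 2 = a `^ x.
Proof.
move=> a0; rewrite -powR_mulrn ?powR_ge0// -powRrM; congr (_ `^ _).
by rewrite mulfVK// pnatr_eq0.
Qed.

(** The values u / B + theta v / A are delta-dense: consecutive v differ by
theta / A = E / (k A^2), and k A^2 >= L^2 D >= E D. *)
Lemma precision_le (R : realType) (beta : R) j : 0 < beta ->
  stheta beta j / (sA beta j)%:R <= sdelta beta j.
Proof.
move=> b0.
have D0 := sD_gt0 j b0; have A0 : 0 < (sA beta j)%:R :> R by rewrite ltr0n sA_gt0.
have k0 : 0 < (sk beta j)%:R :> R by rewrite ltr0n sk_gt0.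
rewrite /stheta /sB natrM /sdelta -mulrA -invfM.
rewrite ler_pdivrMr ?mulr_gt0// -ler_pdivrMl ?invr_gt0// invrK.
have h : sD beta j * (sL beta j)%:R ^+ 2 <= (sk beta j)%:R * (sA beta j)%:R ^+ 2.
  rewrite -(sD_pow j b0) -[X in X * _ <= _](powRr1 (ltW D0)).
  rewrite -[X in _ `^ X * _](addrNK beta) addrC powRD; last first.
    by apply/implyP => _; rewrite gt_eqF.
  rewrite -mulrA ler_wpM2l ?powR_ge0//.
  rewrite -(powR_half_sqr _ (ltW D0)) -exprMn lerXn2r ?nnegrE//.
    by rewrite mulr_ge0// powR_ge0.
  by rewrite mulrC sA_ge.
apply: le_trans (_ : sD beta j * (sL beta j)%:R ^+ 2 <= _); last first.
  by apply: le_trans h _; rewrite expr2 mulrA.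
have := sE_le_sL j b0; have := sL_gt1 j b0 => L1 EL.
apply: ler_wpM2l; first exact: ltW.
by rewrite -natrX ler_nat; nia.
Qed.

Lemma stheta_ge0 (R : realType) (beta : R) j : 0 <= stheta beta j.
Proof. by rewrite divr_ge0. Qed.

Lemma stheta_gt0 (R : realType) (beta : R) j : 0 < beta -> 0 < stheta beta j.
Proof. by move=> b0; rewrite divr_gt0// ltr0n ?sE_gt0// sB_gt0. Qed.

Lemma stheta_le (R : realType) (beta : R) j : 0 < beta -> stheta beta j <= 1 / 2.
Proof.
move=> b0; rewrite /stheta ler_pdivrMr ?ltr0n ?sB_gt0//.
suff : (2 * sE beta j <= sB beta j)%N by rewrite -(ler_nat R) natrM; lra.
have := sE_le_sL j b0; have := sL_le_sA beta j; have := sk_ge j b0.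
by have := sL_gt1 j b0; rewrite /sB; nia.
Qed.

(** Powers of L are negligible against powers of D. *)
Lemma sD_pow_ge (R : realType) (beta eta : R) (c j : nat) :
  0 < beta -> beta <= 1 -> 0 <= eta -> c%:R <= j.+1%:R * eta ->
  (80 * sL beta j)%:R ^+ c <= sD beta j `^ eta.
Proof.
move=> b0 b1 eta0 h.
apply: (@le_trans _ _ ((sk beta j)%:R `^ eta)); last first.
  apply: ge0_ler_powR => //; rewrite ?nnegrE//; last exact: sk_le_sD.
  exact/ltW/sD_gt0.
rewrite /sk /scale_k natrX -!powR_mulrn// -powRrM.
apply: ler_powR => //; rewrite ler1n muln_gt0/=.
by rewrite (ltnW (sL_gt1 j b0)).
Qed.

Lemma sL_cofinal (R : realType) (beta c e : R) : 0 < beta -> 0 < e -> 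
  exists j0, forall j, (j0 <= j)%N -> c / (sL beta j)%:R <= e.
Proof.
move=> b0 e0; exists (Num.truncn (c / e)) => j jj.
have L0 : 0 < (sL beta j)%:R :> R by rewrite ltr0n ltnW// sL_gt1.
rewrite ler_pdivrMr// mulrC -ler_pdivrMr//.
apply: ltW; apply: lt_le_trans (truncnS_gt _) _.
by rewrite ler_nat (leq_trans _ (ltnW (sL_gt j b0))).
Qed.

(** * Nodes and the Cantor set of parameters *)

(** The nodes of level j, for i <= k_j. *)
Definition node (R : realType) (beta : R) (j i : nat) : R :=
  (1 + i%:R / (sk beta j)%:R - stheta beta j)^-1.

Definition near_node (R : realType) (beta : R) (j : nat) (s : R) : Prop :=
  exists2 i, (i <= sk beta j)%N & `|s - node beta j i| <= sdelta beta j.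

(** The parameters that are within delta_j of a node of level j, for all j. *)
Definition node_cantor (R : realType) (beta : R) : set R :=
  [set s | forall j, near_node beta j s].

Lemma node_bounds (R : realType) (beta : R) (j i : nat) : 0 < beta ->
  (i <= sk beta j)%N -> 1 / 2 <= node beta j i <= 2.
Proof.
move=> b0 ik; have k0 : 0 < (sk beta j)%:R :> R by rewrite ltr0n sk_gt0.
have i0 : 0 <= i%:R / (sk beta j)%:R :> R by rewrite divr_ge0.
have i1 : i%:R / (sk beta j)%:R <= 1 :> R by rewrite ler_pdivrMr// mul1r ler_nat.
have t0 := stheta_ge0 beta j; have t1 := stheta_le j b0.
rewrite /node; set u := _ - _.
have [u1 u2] : 1 / 2 <= u /\ u <= 2 by rewrite /u; split; lra.
have u0 : 0 < u by lra.
apply/andP; split.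
  by rewrite -[u^-1]div1r ler_pdivlMr//; lra.
by rewrite -[u^-1]div1r ler_pdivrMr//; lra.
Qed.

(** There are K consecutive nodes in [x - d, x] as soon as K <= d k, if this
interval is contained in [2/3, 1], which the nodes of every level span. *)
Lemma node_family (R : realType) (beta x d : R) (j K : nat) : 0 < beta ->
  x <= 1 -> 2 / 3 <= x - d -> K%:R <= d * (sk beta j)%:R ->
  exists i0, forall l, (l < K)%N ->
    (i0 + l <= sk beta j)%N /\ x - d <= node beta j (i0 + l) <= x.
Proof.
move=> b0 x1 xd Kd; have k0 : 0 < (sk beta j)%:R :> R by rewrite ltr0n sk_gt0.
set k : R := (sk beta j)%:R in Kd k0 *.
have d0 : 0 <= d.
  have : 0 <= d * k by apply: le_trans Kd; rewrite ler0n.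
  by rewrite pmulr_lge0.
have x0 : 0 < x by lra.
have ix1 : 1 <= x^-1 by rewrite invf_ge1.
have t0 := stheta_ge0 beta j; have t1 := stheta_le j b0.
(* The index i at which 1 + i/k - theta passes 1/x, before rounding. *)
pose a := k * (stheta beta j + x^-1 - 1).
have a0 : 0 <= a by rewrite mulr_ge0 ?(ltW k0)//; lra.
have ak : a / k = stheta beta j + x^-1 - 1 by rewrite /a mulrAC mulfV ?mul1r// gt_eqF.
exists (Num.truncn a).+1 => l lK.
set i := ((Num.truncn a).+1 + l)%N.
have ia : a < i%:R.
  by apply: lt_le_trans (truncnS_gt a) _; rewrite ler_nat leq_addr.
have ia' : i%:R <= a + K%:R.
  apply: (@le_trans _ _ ((Num.truncn a)%:R + K%:R)); last by rewrite lerD2r truncn_le.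
  by rewrite -natrD ler_nat /i addSn -addnS leq_add2l.
rewrite /node -/k; set u := 1 + i%:R / k - stheta beta j.
have u1 : x^-1 < u.
  have : a / k < i%:R / k by rewrite ltr_pM2r// invr_gt0.
  by rewrite ak /u; lra.
have u2 : u <= x^-1 + d.
  have : i%:R / k <= a / k + K%:R / k by rewrite -mulrDl ler_pM2r// invr_gt0.
  have : K%:R / k <= d by rewrite ler_pdivrMr.
  by rewrite ak /u; lra.
have u0 : 0 < u by lra.
have low : x - d <= u^-1.
  rewrite -[u^-1]div1r ler_pdivlMr//.
  have := mulVf (lt0r_neq0 x0); nra.
split; last by rewrite low/= -[leRHS]invrK lef_pV2 ?posrE ?invr_gt0// ltW.
have : u <= 3 / 2.
  have : 2 / 3 <= u^-1 by lra.
  rewrite -[u^-1]div1r ler_pdivlMr//; lra.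
rewrite -(ler_nat R) -/k => uu; have : i%:R / k <= 1 by rewrite /u in uu; lra.
by rewrite ler_pdivrMr// mul1r.
Qed.

Lemma node_separated (R : realType) (beta : R) (j i i' : nat) : 0 < beta ->
  (i < i')%N -> 2 / 3 <= node beta j i -> 2 / 3 <= node beta j i' ->
  (i' - i)%:R * (4 / 9 / (sk beta j)%:R) <= `|node beta j i' - node beta j i|.
Proof.
move=> b0 ii'; have k0 : 0 < (sk beta j)%:R :> R by rewrite ltr0n sk_gt0.
rewrite /node; set k : R := (sk beta j)%:R in k0 *.
set u := 1 + i%:R / k - _; set v := 1 + i'%:R / k - _ => u1 v1.
have u0 : 0 < u by rewrite -invr_gt0; lra.
have v0 : 0 < v by rewrite -invr_gt0; lra.
have vu : v - u = (i' - i)%:R / k by rewrite natrB ?(ltnW ii')// /v /u; field; rewrite gt_eqF.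
have -> : v^-1 - u^-1 = - (v^-1 * u^-1 * (v - u)) by field; rewrite !gt_eqF.
rewrite normrN vu ger0_norm ?mulr_ge0 ?invr_ge0 ?ler0n ?(ltW k0) ?(ltW u0) ?(ltW v0)//.
rewrite mulrCA ler_wpM2r ?divr_ge0 ?(ltW k0)//.
nra.
Qed.

(** Centres of level-j intervals of the Cantor construction: the interval of
radius delta_j is contained in [2/3, 1 + delta_j] and in the neighbourhoods of
the nodes of all levels up to j. *)
Definition good_node (R : realType) (beta : R) (j : nat) : set R :=
  [set x | [/\ x <= 1, 2 / 3 <= x - sdelta beta j &
    forall i s, (i <= j)%N -> `|s - x| <= sdelta beta j -> near_node beta i s]].

(** The number of children of a level-j interval; if x is its centre, theirs are
nodes in [x - delta_j / 2, x]. *)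
Definition sK (R : realType) (beta : R) (j : nat) : nat :=
  Num.truncn (sdelta beta j * (sk beta j.+1)%:R / 2).

Lemma sK_le (R : realType) (beta : R) j : 0 < beta ->
  (sK beta j)%:R <= sdelta beta j / 2 * (sk beta j.+1)%:R.
Proof.
move=> b0; rewrite mulrAC truncn_le divr_ge0// mulr_ge0//.
exact/ltW/sdelta_gt0.
Qed.

Lemma sK_ge (R : realType) (beta : R) j : 0 < beta ->
  40 <= sdelta beta j * (sk beta j.+1)%:R / 4 <= (sK beta j)%:R.
Proof.
move=> b0; have D0 := sD_gt0 j b0.
have h : 160 <= sdelta beta j * (sk beta j.+1)%:R.
  by rewrite /sdelta mulrC ler_pdivlMr// sD_le_skS.
have := truncnS_gt (sdelta beta j * (sk beta j.+1)%:R / 2).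
rewrite -[X in _ < X]natr1 -/(sK beta j) => h'.
by apply/andP; split; lra.
Qed.

Lemma sK_gt0 (R : realType) (beta : R) j : 0 < beta -> (0 < sK beta j)%N.
Proof.
by move=> b0; rewrite -(ltr_nat R); have /andP[h1 h2] := sK_ge j b0; lra.
Qed.

Lemma good_node_children (R : realType) (beta : R) j x :
  0 < beta -> beta <= 1 -> good_node beta j x ->
  exists y : nat -> R,
    (forall l, (l < sK beta j)%N -> good_node beta j.+1 (y l) /\
       `|y l - x| <= sdelta beta j - sdelta beta j.+1) /\
    (forall l l', (l < l')%N -> (l' < sK beta j)%N ->
       (l' - l)%:R * (4 / 9 / (sk beta j.+1)%:R) <= `|y l' - y l|).
Proof.
move=> b0 b1 [x1 xd xn].
have d0 := sdelta_gt0 j b0; have d1 := sdelta_gt0 j.+1 b0.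
have dd := sdeltaS j b0 b1.
have xd2 : 2 / 3 <= x - sdelta beta j / 2 by lra.
have [i0 hi0] := node_family b0 x1 xd2 (sK_le j b0).
exists (fun l => node beta j.+1 (i0 + l)); split => [l lK|l l' ll' lK'].
  have [lk /andP[lx xl]] := hi0 _ lK.
  have nx : `|node beta j.+1 (i0 + l) - x| <= sdelta beta j - sdelta beta j.+1.
    by rewrite ler_norml; apply/andP; split; lra.
  split=> //; split; [lra|lra|] => i s; rewrite leq_eqVlt => /predU1P[->|ij] sn.
    by exists (i0 + l)%N.
  apply: (xn i s ij).
  by have := ler_distD (node beta j.+1 (i0 + l)) s x; lra.
have [lk /andP[lx xl]] := hi0 _ (ltn_trans ll' lK').
have [lk' /andP[lx' xl']] := hi0 _ lK'.
rewrite -(subnDl i0); apply: node_separated => //; [by rewrite ltn_add2l|lra|lra].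
Qed.

Lemma good_node_exists (R : realType) (beta : R) j :
  0 < beta -> beta <= 1 -> exists x, good_node beta j x.
Proof.
move=> b0 b1; elim: j => [|j [x gx]]; last first.
  have [y [hy _]] := good_node_children b0 b1 gx.
  by exists (y 0%N); have [] := hy _ (sK_gt0 j b0).
have k1 : 160 <= (sk beta 0)%:R :> R.
  by rewrite ler_nat; have := sk_ge 0 b0; have := sL_gt1 0 b0; lia.
have d0 := sdelta_gt0 0 b0.
have d1 : sdelta beta 0 <= 1 / 160.
  have := sk_le_sD 0 b0 b1; rewrite /sdelta => h.
  by rewrite -[(sD _ _)^-1]div1r ler_pdivrMr ?sD_gt0//; lra.
have [|||i0 hi] := @node_family R beta 1 (1 / 6) 0 1 b0; try lra.
have [|ik /andP[n1 n2]] := hi 0%N => //.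
exists (node beta 0 (i0 + 0)); split; [lra|lra|] => i s.
by rewrite leqn0 => /eqP -> sn; exists (i0 + 0)%N.
Qed.

(** * Lower bound on covers of the Cantor set *)

(** The weight given at level j to a set of diameter s.  The factor 24 absorbs
the constants lost when counting the children that a set meets. *)
Definition gauge (R : realType) (beta t : R) (j : nat) (s : R) : R :=
  Num.min 1 ((24 * s * sD beta j) `^ t).

Lemma gauge_ge0 (R : realType) (beta t : R) j s : 0 <= gauge beta t j s.
Proof. by rewrite le_min ler01 powR_ge0. Qed.

(** A set of diameter s meets at most 10 + 3 k_(j+1) s children.  The second term
is controlled by s <= delta_j / 24, the first by k_(j+1) being a large multiple
of D_j D_(j+1)^t; the hypothesis on j says that level j is late enough for
this. *)
Lemma gauge_step (R : realType) (beta t s : R) j :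
  0 < beta -> beta <= 1 -> 0 < t -> t < beta -> 1 <= j.+2%:R * (beta - t) ->
  0 < s -> gauge beta t j s < 1 ->
  (1 + (s + 2 * sdelta beta j.+1) / (4 / 9 / (sk beta j.+1)%:R)) *
    gauge beta t j.+1 s <= (sK beta j)%:R * gauge beta t j s.
Proof.
move=> b0 b1 t0 tb jt s0.
have D0 := sD_gt0 j b0; have D1 := sD_gt0 j.+1 b0.
have k0 : 0 < (sk beta j.+1)%:R :> R by rewrite ltr0n sk_gt0.
set rho := 24 * s * sD beta j; have rho0 : 0 < rho by rewrite !mulr_gt0.
rewrite {1}/gauge -/rho gt_min ltxx /= => rt1.
have r1 : rho < 1.
  rewrite ltNge; apply/negP => r1; move: rt1; apply/negP; rewrite -leNgt.
  by rewrite -[leLHS](powRr0 rho) ler_powR// ltW.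
have -> : gauge beta t j s = rho `^ t by rewrite /gauge -/rho; apply/min_idPr/ltW.
set k : R := (sk beta j.+1)%:R in k0 *.
set G := gauge beta t j.+1 s.
have G0 : 0 <= G by exact: gauge_ge0.
have G1 : G <= 1 by rewrite ge_min lexx.
have kd : k * sdelta beta j.+1 <= 1.
  by rewrite /sdelta ler_pdivrMr// mul1r; exact: sk_le_sD.
have c1 : 1 + (s + 2 * sdelta beta j.+1) / (4 / 9 / k) <= 10 + 3 * (k * s).
  have -> : (s + 2 * sdelta beta j.+1) / (4 / 9 / k) =
      9 / 4 * (k * s) + 9 / 2 * (k * sdelta beta j.+1) by field; rewrite gt_eqF.
  have : 0 <= k * s by rewrite mulr_ge0// ltW.
  lra.
apply: le_trans (ler_wpM2r G0 c1) _.
have /andP[_ K1] := sK_ge j b0.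
apply: le_trans (_ : sdelta beta j * k / 4 * rho `^ t <= _); last first.
  by rewrite ler_wpM2r ?powR_ge0.
rewrite mulrDl.
have dk0 : 0 <= sdelta beta j * k / 8.
  by rewrite divr_ge0// mulr_ge0 ?(ltW k0)// ltW// sdelta_gt0.
(* rho <= rho^t because rho < 1 and t <= 1. *)
have h1 : 3 * (k * s) * G <= sdelta beta j * k / 8 * rho `^ t.
  apply: (@le_trans _ _ (3 * (k * s))).
    by rewrite ler_piMr// mulr_ge0// mulr_ge0// ltW.
  have -> : 3 * (k * s) = sdelta beta j * k / 8 * rho.
    by rewrite /rho /sdelta; field; rewrite gt_eqF.
  apply: ler_wpM2l => //; apply: ger1_powR; last by rewrite ltW// (lt_le_trans tb).
  by rewrite rho0 ltW.
have h2 : 10 * G <= sdelta beta j * k / 8 * rho `^ t.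
  apply: (@le_trans _ _ (10 * (rho `^ t * sD beta j.+1 `^ t))).
    rewrite ler_wpM2l// ge_min; apply/orP; right.
    rewrite -powRM ?(ltW rho0) ?(ltW D1)//; apply: ge0_ler_powR; rewrite ?nnegrE//.
    - exact: ltW.
    - by rewrite !mulr_ge0 ?ltW.
    - by rewrite mulr_ge0 ?ltW.
    rewrite /rho ler_pM2r// ler_peMr//; last exact: sD_ge1.
    by rewrite mulr_ge0// ltW.
  rewrite mulrCA mulrC ler_wpM2r ?powR_ge0//.
  have -> : k = sD beta j.+1 `^ t * sD beta j.+1 `^ (beta - t).
    rewrite -powRD; last by apply/implyP => _; rewrite gt_eqF.
    by rewrite addrC subrK sD_pow.
  have hk : 80 * sD beta j <= sD beta j.+1 `^ (beta - t).
    have b1' : 0 <= beta - t by lra.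
    have := @sD_pow_ge R beta (beta - t) 1 j.+1 b0 b1 b1' jt.
    by rewrite expr1 natrM; have := sD_le_sLS j b0; lra.
  have -> : 10 * sD beta j.+1 `^ t =
      sdelta beta j * (sD beta j.+1 `^ t * (80 * sD beta j)) / 8.
    by rewrite /sdelta; field; rewrite gt_eqF.
  rewrite ler_wpM2r// ler_wpM2l//; first exact/ltW/sdelta_gt0.
  by rewrite ler_wpM2l// powR_ge0.
lra.
Qed.

Lemma node_cantor_cover (R : realType) (beta t : R) :
  0 < beta -> beta <= 1 -> 0 < t -> t < beta ->
  exists2 eta, 0 < eta & forall (F : nat -> set R) (r : nat -> R),
    (forall k, 0 < r k) ->
    (forall k a b, F k a -> F k b -> `|a - b| <= r k) ->
    node_cantor beta `<=` \bigcup_k F k ->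
    (eta%:E <= \sum_(0 <= k <oo) (r k `^ t)%:E)%E.
Proof.
move=> b0 b1 t0 tb.
have bt : 0 < beta - t by rewrite subr_gt0.
have [j0 hj0] : exists j0, (beta - t)^-1 < j0.+1%:R.
  by exists (Num.truncn ((beta - t)^-1)); exact: truncnS_gt.
have c0 : 0 < (24 * sD beta j0) `^ t by rewrite powR_gt0// mulr_gt0// sD_gt0.
exists ((24 * sD beta j0) `^ t)^-1; first by rewrite invr_gt0.
move=> F r r0 rF cov.
have [x0 gx0] := good_node_exists j0 b0 b1.
have key := @cantor_gauge_cover R (fun j => good_node beta (j0 + j))
  (fun j => sdelta beta (j0 + j)) (fun j => 4 / 9 / (sk beta (j0 + j).+1)%:R)
  (fun j => sK beta (j0 + j)) (fun j => gauge beta t (j0 + j)) F r x0.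
have : (1 <= \sum_(0 <= k <oo) (gauge beta t (j0 + 0) (r k))%:E)%E.
  apply: key; [| | | | | | | | exact: r0|exact: rF|].
  - by rewrite addn0.
  - by move=> j; rewrite ltW// sdelta_gt0.
  - by move=> j; rewrite !divr_gt0// ltr0n sk_gt0.
  - by move=> j; exact: sK_gt0.
  - by move=> j x; rewrite addnS; exact: good_node_children.
  - by move=> j s; exact: gauge_ge0.
  - move=> j s; rewrite addnS; apply: gauge_step => //.
    rewrite -ler_pdivrMr// mul1r; apply/ltW.
    by apply: lt_le_trans hj0 _; rewrite ler_nat; lia.
  - move=> s s0; have [j1 hj1] := sL_cofinal 1 b0 s0.
    exists j1; rewrite /gauge le_min lexx/=.
    rewrite -[leLHS](powRr0 (24 * s * sD beta (j0 + j1))).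
    apply: ler_powR; last exact: ltW.
    have := hj1 (j0 + j1)%N (leq_addl _ _).
    have L0 : 0 < (sL beta (j0 + j1))%:R :> R by rewrite ltr0n ltnW// sL_gt1.
    rewrite ler_pdivrMr// => h.
    have LD : (sL beta (j0 + j1))%:R <= sD beta (j0 + j1).
      apply: le_trans (sk_le_sD _ b0 b1); rewrite ler_nat.
      by apply: leq_trans (sk_ge _ b0); rewrite leq_pmull.
    by have := ler_wpM2l (ltW s0) LD; lra.
  - move=> s hs; have [|k _ Fk] := cov s; last by exists k.
    move=> j; have [x [_ _ nx] sx] := hs j.
    by apply: (nx j s _ sx); exact: leq_addl.
rewrite addn0 => one.
rewrite -[leLHS]mule1 lee_pdivrMl// -nneseriesZl; last by move=> *; rewrite lee_fin powR_ge0.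
apply: le_trans one _; apply: lee_nneseries => k *.
  by rewrite lee_fin gauge_ge0.
rewrite -EFinM lee_fin ge_min; apply/orP; right.
have rk0 := ltW (r0 k); have D0 := ltW (sD_gt0 j0 b0).
by rewrite mulrAC [leLHS]powRM// mulr_ge0.
Qed.

(** * The intercept of a line of given slope *)

(** Starting from any intercept W / A_j, a change by at most 1 / E_j makes the
slope d equal to u / B_j + theta_j V / A_j up to delta_j: the remainder of
d - theta_j W / A_j modulo 1 / B_j is at most theta_j / E_j, and is absorbed by
steps theta_j / A_j. *)
Lemma intercept_step (R : realType) (beta d : R) (j W : nat) : 0 < beta ->
  exists V : nat, [/\ (W <= V)%N,
    (V - W)%:R / (sA beta j)%:R <= (sE beta j)%:R^-1 :> R &
    exists u : int, `|d - u%:~R / (sB beta j)%:R -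
      stheta beta j * (V%:R / (sA beta j)%:R)| <= sdelta beta j].
Proof.
move=> b0.
have A0 : 0 < (sA beta j)%:R :> R by rewrite ltr0n sA_gt0.
have B0 : 0 < (sB beta j)%:R :> R by rewrite ltr0n sB_gt0.
have E0 : 0 < (sE beta j)%:R :> R by rewrite ltr0n sE_gt0.
have th0 := stheta_gt0 j b0.
have prec := precision_le j b0.
have thB : stheta beta j * (sB beta j)%:R = (sE beta j)%:R.
  by rewrite /stheta divfK// gt_eqF.
set A : R := (sA beta j)%:R in A0 prec *.
set B : R := (sB beta j)%:R in B0 thB *.
set E : R := (sE beta j)%:R in E0 thB *.
set th := stheta beta j in th0 thB prec *.
pose y := d - th * (W%:R / A).
pose u := Num.floor (y * B).
pose z := y - u%:~R / B.
have /andP[u1 u2] := floor_itv (y * B).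
have z0 : 0 <= z by rewrite subr_ge0 ler_pdivrMr.
have z1 : z * B < 1.
  rewrite /z mulrBl divfK ?gt_eqF//; move: u2; rewrite -/u intrD; lra.
have zA0 : 0 <= z * A / th by rewrite divr_ge0 ?mulr_ge0// ltW.
have := truncn_itv zA0.
set i := Num.truncn _ => /andP[i1 i2].
exists (W + i)%N; split; first exact: leq_addr.
  rewrite addKn ler_pdivrMr//; apply: le_trans i1 _.
  rewrite ler_pdivrMr// -thB.
  have -> : (th * B)^-1 * A * th = A / B by field; rewrite !gt_eqF.
  by rewrite ler_pdivlMr//; nra.
exists u; rewrite natrD mulrDl mulrDr.
have -> : d - u%:~R / B - (th * (W%:R / A) + th * (i%:R / A)) =
   z - th * (i%:R / A) by rewrite /z /y; ring.
have h1 : th * (i%:R / A) <= z.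
  by rewrite mulrC -ler_pdivlMr// ler_pdivrMr// mulrAC.
have h2 : z < th * (i%:R / A) + th / A.
  have -> : th * (i%:R / A) + th / A = i.+1%:R * (th / A) by rewrite -natr1; ring.
  rewrite mulrA ltr_pdivlMr//.
  by move: i2; rewrite ltr_pdivrMr.
by rewrite ger0_norm ?subr_ge0//; lra.
Qed.

(** The intercept attached to the slope d, good at all levels at once. *)
Lemma intercept (R : realType) (beta d : R) : 0 < beta -> beta <= 1 ->
  exists2 b : R, `|b| <= 2 & forall j, exists (V : nat) (u : int),
    `|b - V%:R / (sA beta j)%:R| <= sdelta beta j /\
    `|d - u%:~R / (sB beta j)%:R -
      stheta beta j * (V%:R / (sA beta j)%:R)| <= sdelta beta j.
Proof.
move=> b0 b1.
pose f j W := projT1 (cid (@intercept_step R beta d j W b0)).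
have fP j W := projT2 (cid (@intercept_step R beta d j W b0)).
pose V := fix V j := if j is i.+1 then
  f i.+1 (V i * (sA beta i.+1 %/ sA beta i))%N else f 0%N 0%N.
pose c j : R := (V j)%:R / (sA beta j)%:R.
have A0 j : 0 < (sA beta j)%:R :> R by rewrite ltr0n sA_gt0.
have Adiv j : (sA beta j.+1 %/ sA beta j * sA beta j)%N = sA beta j.+1.
  by rewrite divnK// (dvdn_trans _ (sL_dvd_sA _ _))// sLS dvdn_mulr.
(* V j / A_j is also a multiple of 1 / A_(j+1), from which level j + 1 starts. *)
have step j : `|c j.+1 - c j| <= sdelta beta j - sdelta beta j.+1.
  have [WV h _] := fP j.+1 (V j * (sA beta j.+1 %/ sA beta j))%N.
  have -> : c j.+1 - c j = (V j.+1 - V j * (sA beta j.+1 %/ sA beta j))%N%:R /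
      (sA beta j.+1)%:R.
    rewrite natrB// mulrBl /c; congr (_ - _).
    set q := (sA beta j.+1 %/ sA beta j)%N.
    have Aq : (sA beta j.+1)%:R = q%:R * (sA beta j)%:R :> R.
      by rewrite -natrM Adiv.
    have q0 : 0 < q%:R :> R by move: (A0 j.+1); rewrite Aq pmulr_lgt0.
    by rewrite Aq (natrM _ (V j)); field; rewrite !gt_eqF.
  rewrite ger0_norm ?divr_ge0//; apply: le_trans h _.
  have D0 := sD_gt0 j b0; have d0 := sdelta_gt0 j b0; have dS := sdeltaS j b0 b1.
  apply: (@le_trans _ _ (sdelta beta j / 2)); last by lra.
  rewrite /sdelta -invfM lef_pV2 ?posrE ?mulr_gt0//.
  by rewrite mulrC sE_ge.
have [b hb] := nested_intervals (fun j => ltW (sdelta_gt0 j b0)) step.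
exists b.
  have [_] := fP 0%N 0%N; rewrite subn0 -/(f 0%N 0%N) -/(c 0%N) => h _.
  have := hb 0%N; have := ler_distD (c 0%N) b 0; rewrite !subr0.
  have c0 : 0 <= c 0%N by rewrite divr_ge0.
  rewrite (ger0_norm c0); have := sdelta_le1 0 b0.
  have : (sE beta 0)%:R^-1 <= 1 :> R by rewrite invf_le1 ?ler1n ?ltr0n sE_gt0.
  by lra.
move=> j; have := hb j; rewrite /c => hbj; exists (V j).
have [u hu] : exists u : int, `|d - u%:~R / (sB beta j)%:R -
      stheta beta j * ((V j)%:R / (sA beta j)%:R)| <= sdelta beta j.
  by case: (j) => [|i]; [have [] := fP 0%N 0%N|
    have [] := fP i.+1 (V i * (sA beta i.+1 %/ sA beta i))%N].
by exists u.
Qed.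

(** * The compact set *)

(** The grid indices at level j range over [- sG, sG]; as ordinals they are
shifted by [sG]. *)
Definition sG (R : realType) (beta : R) j := (18 * sB beta j)%N.

(** Over a level-j node, a coordinate of the line with slope d and intercept b is
within 4 delta_j of the node times a grid point. *)
Lemma line_near_grid (R : realType) (beta d b s : R) (j i V : nat) (u : int) :
  0 < beta -> `|d| <= 1 -> `|b| <= 2 ->
  `|b - V%:R / (sA beta j)%:R| <= sdelta beta j ->
  `|d - u%:~R / (sB beta j)%:R -
      stheta beta j * (V%:R / (sA beta j)%:R)| <= sdelta beta j ->
  (i <= sk beta j)%N -> `|s - node beta j i| <= sdelta beta j ->
  exists2 g : nat, (g <= 2 * sG beta j)%N &
    `|b + s * d - node beta j i * ((g%:R - (sG beta j)%:R) / (sB beta j)%:R)|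
       <= 4 * sdelta beta j.
Proof.
move=> b0 d1 b2 hV hd ik hs.
have A0 : 0 < (sA beta j)%:R :> R by rewrite ltr0n sA_gt0.
have B0 : 0 < (sB beta j)%:R :> R by rewrite ltr0n sB_gt0.
have k0 : 0 < (sk beta j)%:R :> R by rewrite ltr0n sk_gt0.
have BE : (sB beta j)%:R = (sk beta j)%:R * (sA beta j)%:R :> R by rewrite natrM.
have /andP[n1 n2] := node_bounds b0 ik.
have del0 := sdelta_gt0 j b0; have del1 := sdelta_le1 j b0.
set G := sG beta j.
have GE : G%:R = 18 * (sB beta j)%:R :> R by rewrite natrM.
set A : R := (sA beta j)%:R in hV hd A0 BE *.
set B : R := (sB beta j)%:R in hd B0 BE GE *.
set k : R := (sk beta j)%:R in k0 BE *.
set N := node beta j i in n1 n2 hs *.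
set del := sdelta beta j in hV hd hs del0 del1 *.
set v := V%:R / A in hV hd.
set e := d - u%:~R / B - stheta beta j * v in hd.
(* The exact incidence: u/B + (1 + i/k) V/A has denominator B = k A. *)
pose g' : int := u + ((sk beta j + i) * V)%N%:Z.
have g'E : g'%:~R / B = u%:~R / B + (1 + i%:R / k) * v.
  rewrite /g' intrD mulrDl; congr (_ + _).
  by rewrite -[((_ * _)%N%:Z)%:~R]/((_ * _)%N%:R) natrM natrD -/k BE /v; field; rewrite !gt_eqF.
have Nu : N * (1 + i%:R / k - stheta beta j) = 1.
  rewrite /N /node -/k mulVf//; apply/eqP => h.
  by move: n1; rewrite /N /node -/k h invr0; lra.
have key : b + s * d - N * (g'%:~R / B) = (b - v) + (s - N) * d + N * e.
  have -> : N * (g'%:~R / B) = N * (d - e) + N * (1 + i%:R / k - stheta beta j) * v.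
    by rewrite g'E /e; ring.
  by rewrite Nu; ring.
have N0 : 0 <= N by lra.
have close : `|b + s * d - N * (g'%:~R / B)| <= 4 * del.
  rewrite key.
  have h1 : `|(s - N) * d| <= del by rewrite normrM; apply: le_trans hs; rewrite ler_piMr.
  have h2 : `|N * e| <= 2 * del.
    by rewrite normrM (ger0_norm N0) ler_pM.
  have := ler_normD (b - v + (s - N) * d) (N * e).
  have := ler_normD (b - v) ((s - N) * d); lra.
have s3 : `|s| <= 3.
  have := ler_distD N s 0; rewrite !subr0 (ger0_norm N0); lra.
have gbound : `|g'%:~R / B| <= 18.
  have h1 : `|s * d| <= 3.
    by rewrite normrM; apply: le_trans s3; rewrite ler_piMr.
  have h2 : `|N * (g'%:~R / B)| <= 9.
    have := ler_distD (b + s * d) (N * (g'%:~R / B)) 0.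
    rewrite !subr0 distrC; have := ler_normD b (s * d); lra.
  move: h2; rewrite normrM (ger0_norm N0).
  by have := normr_ge0 (g'%:~R / B); nra.
have [gG1 gG2] : - G%:R <= g'%:~R :> R /\ g'%:~R <= G%:R :> R.
  move: gbound; rewrite ler_norml => /andP[].
  rewrite ler_pdivlMr// ler_pdivrMr// GE; lra.
have gG0 : 0 <= g' + G%:Z by rewrite -(ler_int R) intrD /=; rewrite -[(G%:Z)%:~R]/(G%:R); lra.
have [g gE] : exists g : nat, g' + G%:Z = g%:Z.
  by exists (absz (g' + G%:Z)); rewrite gez0_abs.
have gR : g%:R = g'%:~R + G%:R :> R.
  by rewrite -[g%:R]/((g%:Z)%:~R) -gE intrD.
exists g; first by rewrite -(ler_nat R) natrM gR; lra.
by rewrite gR addrK.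
Qed.

(** The points of level j: a node and n' grid indices. *)
Definition box_index (R : realType) (beta : R) (n' j : nat) : finType :=
  ('I_(sk beta j).+1 * {ffun 'I_n' -> 'I_(2 * sG beta j).+1})%type.

(** The point with index [c] when the dominant coordinate is [m]: coordinate [m]
is the node, the others are the node times a grid point. *)
Definition box_center (R : realType) (beta : R) (n' j : nat) (m : 'I_n'.+1)
    (c : box_index beta n' j) (p : 'I_n'.+1) : R :=
  if unlift m p is Some l then
    node beta j c.1 * (((c.2 l)%:R - (sG beta j)%:R) / (sB beta j)%:R)
  else node beta j c.1.

(** A cube around such a point, i.e. a ball for the sup norm. *)
Definition box (R : realType) (beta : R) (n' j : nat) (m : 'I_n'.+1)
    (c : box_index beta n' j) : set 'rV[R]_n'.+1 :=
  [set x | forall p, `|x 0 p - box_center m c p| <= 4 * sdelta beta j].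

(** The set S of the theorem, in dimension n' + 1. *)
Definition furstenberg_set (R : realType) (beta : R) (n' : nat) :
    set 'rV[R]_n'.+1 :=
  [set x | exists m, forall j, exists c : box_index beta n' j, box m c x].

Arguments furstenberg_set {R} beta n' _.

Lemma box_compact (R : realType) (beta : R) (n' j : nat) (m : 'I_n'.+1)
    (c : box_index beta n' j) : compact (box m c).
Proof.
pose r := 4 * sdelta beta j.
have := @rV_compact R n'.+1
  (fun p => `[box_center m c p - r, box_center m c p + r]%classic).
move=> /(_ (fun p => @segment_compact _ _ _)).
congr compact; apply/seteqP; split => x /= h p; have := h p; rewrite in_itv/= ler_distl//.
Qed.

Lemma furstenberg_set_compact (R : realType) (beta : R) (n' : nat) :
  compact (furstenberg_set beta n').
Proof.
have -> : furstenberg_set beta n' = \bigcup_(m in [set: 'I_n'.+1]) \bigcap_j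
    \bigcup_(c in [set: box_index beta n' j]) box m c.
  apply/seteqP; split => x.
    by move=> [m h]; exists m => // j _; have [c hc] := h j; exists c.
  by move=> [m _ h]; exists m => j; have [c _ hc] := h j I; exists c.
have Uc j (m : 'I_n'.+1) :
    compact (\bigcup_(c in [set: box_index beta n' j]) box m c).
  rewrite -bigsetU_fset_set; last exact: finite_finset.
  by apply: bigsetU_compact => c _; exact: box_compact.
rewrite -bigsetU_fset_set; last exact: finite_finset.
apply: bigsetU_compact => m _.
(* Intersecting with level 0 once more exhibits a closed subset of a compact
   set. *)
set Z := \bigcap_j _.
have <- : \bigcup_(c in [set: box_index beta n' 0]) box m c `&` Z = Z.
  by apply: setIidr; exact: (bigcap_inf (i := 0%N)).
apply: compact_closedI => //; apply: closed_bigI => j _.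
by apply: compact_closed => //; exact: norm_hausdorff.
Qed.

(** * Dimension of the compact set and of its sections *)

Lemma coord_le_enorm (R : realType) n (x : 'rV[R]_n) p : `|x 0 p| <= enorm x.
Proof.
rewrite -sqrtr_sqr; apply: ler_wsqrtr.
by rewrite (bigD1 p)//= lerDl; apply: sumr_ge0 => i _; exact: sqr_ge0.
Qed.

Lemma enorm_le (R : realType) n (x : 'rV[R]_n) (c : R) : 0 <= c ->
  (forall p, `|x 0 p| <= c) -> enorm x <= n%:R * c.
Proof.
move=> c0 h; have nc0 : 0 <= n%:R * c by rewrite mulr_ge0.
rewrite -(ger0_norm nc0) -sqrtr_sqr; apply: ler_wsqrtr.
apply: (@le_trans _ _ (\sum_(i < n) c ^+ 2)).
  apply: ler_sum => i _; rewrite -real_normK ?num_real//.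
  by rewrite lerXn2r ?nnegrE.
rewrite sumr_const card_ord exprMn -[leLHS]mulr_natl ler_wpM2r ?sqr_ge0//.
by rewrite -natrX ler_nat; nia.
Qed.

(** Constants and powers of L are absorbed by a gain D^(- eta) at some level. *)
Lemma scale_estimate (R : realType) (beta C eta e : R) (c : nat) :
  0 < beta -> beta <= 1 -> 0 <= C -> 0 < eta -> 0 < e ->
  exists j, (80 * sL beta j)%:R ^+ c * C * sD beta j `^ (- eta) <= e /\
            C * sdelta beta j <= e.
Proof.
move=> b0 b1 C0 eta0 e0.
have [j0 hj0] := sL_cofinal C b0 e0.
pose j := (j0 + Num.truncn (c.+1%:R / eta))%N.
exists j; have D0 := sD_gt0 j b0.
have L0 : 0 < (sL beta j)%:R :> R by rewrite ltr0n ltnW// sL_gt1.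
have CL : C / (sL beta j)%:R <= e by apply: hj0; exact: leq_addr.
have big : (80 * sL beta j)%:R ^+ c.+1 <= sD beta j `^ eta.
  apply: sD_pow_ge => //; first exact: ltW.
  rewrite -ler_pdivrMr//; apply/ltW/(lt_le_trans (truncnS_gt _)).
  by rewrite ler_nat ltnS leq_addl.
split; apply: le_trans CL; last first.
  rewrite ler_wpM2l// /sdelta lef_pV2 ?posrE//.
  apply: le_trans (sk_le_sD _ b0 b1); rewrite ler_nat.
  by apply: leq_trans (sk_ge _ b0); rewrite leq_pmull.
have X0 : 0 < sD beta j `^ eta by exact: powR_gt0.
move: big; rewrite exprSr natrM powRN.
set P : R := _ ^+ c; set X := _ `^ _ in X0 * => big.
have P0 : 0 <= P by rewrite exprn_ge0// mulr_ge0.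
rewrite ler_pdivrMr// mulrAC ler_pdivlMr//.
have h1 := ler_wpM2l C0 big.
have : 0 <= C * (P * (sL beta j)%:R) by rewrite !mulr_ge0.
lra.
Qed.

Lemma furstenberg_set_dim (R : realType) (beta : R) (n' : nat) :
  0 < beta -> beta <= 1 ->
  (hausdorff_dim (furstenberg_set beta n') <=
    (n'%:R / 2 + (n'%:R + 2) / 2 * beta)%:E)%E.
Proof.
move=> b0 b1; set sigma := n'%:R / 2 + _.
have s0 : 0 <= sigma.
  by rewrite addr_ge0// ?divr_ge0// mulr_ge0 ?ltW// divr_ge0// addr_ge0.
apply: hausdorff_dim_le => // t e st e0.
pose q0 : R := 8 * n'.+1%:R.
pose C : R := Num.max q0 (2 * n'.+1%:R * q0 `^ t).
have C0 : 0 <= C by rewrite le_max mulr_ge0.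
have ts : 0 < t - sigma by rewrite subr_gt0.
have [j [j1 j2]] := scale_estimate n' b0 b1 C0 ts e0.
have D0 := sD_gt0 j b0; have del0 := sdelta_gt0 j b0.
have L0 : 0 < (sL beta j)%:R :> R by rewrite ltr0n ltnW// sL_gt1.
exists ('I_n'.+1 * box_index beta n' j)%type.
exists (fun z => box z.1 z.2), (q0 * sdelta beta j); split.
- by apply: le_trans j2; rewrite ler_pM2r// le_max lexx.
- move=> [m c] x y bx yx; rewrite /q0 mulrAC mulrC; apply: enorm_le => [|p].
    by rewrite mulr_ge0// ltW.
  rewrite !mxE; have := bx p; have := yx p; move: (box_center _ _ _) => z /=.
  by have := ler_distD z (x 0 p) (y 0 p); rewrite (distrC z); lra.
- by move=> x [m h]; have [c hc] := h j; exists (m, c).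
apply: le_trans j1.
rewrite !card_prod card_ffun !card_ord.
have B0 := sB_gt0 j b0; have k0 := sk_gt0 j b0.
have count : (n'.+1 * ((sk beta j).+1 * (2 * sG beta j).+1 ^ n'))%N%:R <=
   n'.+1%:R * ((2 * (sk beta j)%:R) * (37 * (sB beta j)%:R) ^+ n') :> R.
  rewrite -!natrM -natrX -!natrM ler_nat leq_mul2l/= leq_mul//.
    by rewrite mul2n -addnn -addn1 leq_add2l.
  case: (n') => // i; rewrite leq_exp2r// /sG mulnA.
  by rewrite (_ : 37 = (2 * 18).+1)%N// mulSn -add1n leq_add2r.
apply: le_trans (ler_wpM2r (powR_ge0 _ _) count) _.
(* B = k A is of order L D^((1 + beta)/2). *)
have Bbound : 37 * (sB beta j)%:R <=
    (80 * sL beta j)%:R * sD beta j `^ ((1 + beta) / 2).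
  have -> : (1 + beta) / 2 = beta + (1 - beta) / 2 by field.
  rewrite powRD; last by apply/implyP => _; rewrite gt_eqF.
  rewrite sD_pow// /sB (natrM _ 80) (natrM _ (sk beta j)).
  have := sA_le j b0 b1.
  set x := _ `^ _ => hA; have x0 : 0 <= x by exact: powR_ge0.
  have k0' : 0 <= (sk beta j)%:R :> R by [].
  have h1 := ler_wpM2l k0' hA.
  have : 0 <= (sk beta j)%:R * ((sL beta j)%:R * x).
    by rewrite !mulr_ge0// ltW.
  lra.
have Bpow : (37 * (sB beta j)%:R) ^+ n' <= (80 * sL beta j)%:R ^+ n' *
    sD beta j `^ ((1 + beta) / 2 * n'%:R).
  rewrite powRrM powR_mulrn ?powR_ge0// -exprMn lerXn2r ?nnegrE ?mulr_ge0//.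
  exact: powR_ge0.
rewrite powRM ?mulr_ge0 ?(ltW del0)//.
set P := (80 * sL beta j)%:R ^+ n' in Bpow *.
have P0 : 0 <= P by rewrite exprn_ge0.
have -> : sD beta j `^ (- (t - sigma)) =
   (sk beta j)%:R * sD beta j `^ ((1 + beta) / 2 * n'%:R) * sdelta beta j `^ t.
  have -> : sdelta beta j `^ t = sD beta j `^ (- t).
    by rewrite /sdelta -(powR_inv1 (ltW D0)) -powRrM mulN1r.
  have nz x : (x == 0 :> R) ==> (sD beta j != 0).
    by apply/implyP => _; rewrite gt_eqF.
  rewrite -(sD_pow j b0); set D := sD beta j in nz *.
  rewrite -!powRD //.
  by congr (_ `^ _); rewrite /sigma; field.
set X := _ `^ ((1 + beta) / 2 * n'%:R) in Bpow *.
set Y := sdelta beta j `^ t.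
have X0 : 0 <= X by exact: powR_ge0.
have Y0 : 0 <= Y by exact: powR_ge0.
apply: (@le_trans _ _ (n'.+1%:R * (2 * (sk beta j)%:R * (P * X)) * (q0 `^ t * Y))).
  apply: ler_wpM2r; first by rewrite mulr_ge0// powR_ge0.
  by apply: ler_wpM2l => //; apply: ler_wpM2l => //; rewrite mulr_ge0.
have -> : n'.+1%:R * (2 * (sk beta j)%:R * (P * X)) * (q0 `^ t * Y) =
  P * (2 * n'.+1%:R * q0 `^ t) * ((sk beta j)%:R * X * Y) by ring.
apply: ler_wpM2r; first by rewrite !mulr_ge0.
by apply: ler_wpM2l => //; rewrite le_max lexx orbT.
Qed.

(** A curve parametrized by its coordinate [m], with 1-Lipschitz coordinates,
restricted to the Cantor set: covers project to covers of the Cantor set on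
coordinate [m], which gives the lower bound. *)
Lemma node_cantor_line_dim (R : realType) (beta : R) (n' : nat)
    (m : 'I_n'.+1) (pt : R -> 'rV[R]_n'.+1) :
  0 < beta -> beta <= 1 ->
  (forall s, pt s 0 m = s) ->
  (forall s s' p, `|pt s 0 p - pt s' 0 p| <= `|s - s'|) ->
  hausdorff_dim (pt @` node_cantor beta) = beta%:E.
Proof.
move=> b0 b1 ptm ptlip; apply/eqP; rewrite eq_le; apply/andP; split; last first.
  apply: hausdorff_dim_ge => t t0 tb.
  have [eta eta0 heta] := node_cantor_cover b0 b1 t0 tb.
  exists eta => // F r r0 rF cov.
  apply: (heta (fun k => (fun x : 'rV[R]_n'.+1 => x 0 m) @` F k)) => //.
    move=> k _ _ [x Fx <-] [y Fy <-]; apply: le_trans (rF _ _ _ Fx Fy).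
    by have := coord_le_enorm (x - y) m; rewrite !mxE.
  move=> s Cs; have [|k _ Fk] := cov (pt s); first by exists s.
  by exists k => //; exists (pt s).
apply: hausdorff_dim_le; first exact: ltW.
move=> t e bt e0; pose q0 : R := 2 * n'.+1%:R.
pose C : R := Num.max q0 (2 * q0 `^ t).
have C0 : 0 <= C by rewrite le_max mulr_ge0.
have tb : 0 < t - beta by rewrite subr_gt0.
have [j [j1 j2]] := scale_estimate 0 b0 b1 C0 tb e0.
have D0 := sD_gt0 j b0; have del0 := sdelta_gt0 j b0.
exists 'I_(sk beta j).+1.
exists (fun i : 'I_(sk beta j).+1 => pt @` [set s | `|s - node beta j i| <= sdelta beta j]).
exists (q0 * sdelta beta j); split.
- by apply: le_trans j2; rewrite ler_pM2r// le_max lexx.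
- move=> i _ _ [s /= hs <-] [s' /= hs' <-].
  rewrite /q0 mulrAC mulrC; apply: enorm_le => [|p].
    by rewrite mulr_ge0// ltW.
  rewrite !mxE; apply: le_trans (ptlip s s' p) _.
  by have := ler_distD (node beta j i) s s'; rewrite (distrC (node _ _ _) s'); lra.
- move=> _ [s Cs <-]; have [i ik hs] := Cs j.
  by exists (Ordinal (ik : (i < (sk beta j).+1)%N)); exists s.
rewrite expr0 mul1r in j1; apply: le_trans j1; rewrite card_ord.
have k0 := sk_gt0 j b0.
rewrite powRM ?mulr_ge0 ?(ltW del0)//.
have -> : sD beta j `^ (- (t - beta)) = (sk beta j)%:R * sdelta beta j `^ t.
  have -> : sdelta beta j `^ t = sD beta j `^ (- t).
    by rewrite /sdelta -(powR_inv1 (ltW D0)) -powRrM mulN1r.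
  rewrite -(sD_pow j b0) -powRD; last by apply/implyP => _; rewrite gt_eqF.
  by rewrite opprB.
have Y0 : 0 <= sdelta beta j `^ t by exact: powR_ge0.
have k2 : (sk beta j).+1%:R <= 2 * (sk beta j)%:R :> R.
  by rewrite -natrM ler_nat mul2n -addnn -addn1 leq_add2l.
rewrite !mulrA; apply: ler_wpM2r => //.
apply: (@le_trans _ _ (2 * (sk beta j)%:R * q0 `^ t)).
  by rewrite ler_wpM2r// powR_ge0.
by rewrite mulrAC ler_wpM2r// le_max lexx orbT.
Qed.

Lemma furstenberg_set_line (R : realType) (beta : R) (n' : nat)
    (w : 'rV[R]_n'.+1) :
  0 < beta -> beta <= 1 -> unit_sphere w ->
  exists a : 'rV[R]_n'.+1, exists T : set 'rV[R]_n'.+1,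
    T `<=` affine_line a w `&` furstenberg_set beta n' /\
    hausdorff_dim T = beta%:E.
Proof.
move=> b0 b1 w1.
(* Dividing by the largest coordinate of w makes all slopes at most 1. *)
pose m := [arg max_(p > ord0 : 'I_n'.+1) `|w 0 p|]%O.
have mmax p : `|w 0 p| <= `|w 0 m|.
  by rewrite /m; case: arg_maxP => // i _ h; exact: h.
have wm0 : w 0 m != 0.
  apply/eqP => h; move: w1; rewrite /unit_sphere/= /enorm big1 ?sqrtr0.
    by move/eqP; rewrite eq_sym oner_eq0.
  by move=> p _; have := mmax p; rewrite h normr0 normr_le0 => /eqP ->; rewrite expr0n.
pose d p := w 0 p / w 0 m.
have d1 p : `|d p| <= 1.
  by rewrite /d normrM normfV ler_pdivrMr ?normr_gt0// mul1r.
pose b p := s2val (cid2 (@intercept R beta (d p) b0 b1)).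
have b2 p : `|b p| <= 2 := s2valP (cid2 (@intercept R beta (d p) b0 b1)).
have hb p := s2valP' (cid2 (@intercept R beta (d p) b0 b1)).
pose a : 'rV[R]_n'.+1 := \row_p (if p == m then 0 else b p).
pose pt s : 'rV[R]_n'.+1 := a + (s / w 0 m) *: w.
have ptE s p : pt s 0 p = a 0 p + s * d p by rewrite !mxE mulrAC mulrA.
have ptm s : pt s 0 m = s.
  by rewrite ptE mxE eqxx add0r /d mulfV// mulr1.
exists a, (pt @` node_cantor beta); split; last first.
  apply: (@node_cantor_line_dim R beta n' m) => // s s' p.
  rewrite !ptE; have -> : a 0 p + s * d p - (a 0 p + s' * d p) = (s - s') * d p by ring.
  by rewrite normrM ler_piMr.
move=> _ [s Cs <-]; split; first by exists (s / w 0 m).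
exists m => j; have [i ik hs] := Cs j.
have del0 := sdelta_gt0 j b0.
have grid l : exists g : 'I_(2 * sG beta j).+1,
    `|b l + s * d l - node beta j i *
       ((g%:R - (sG beta j)%:R) / (sB beta j)%:R)| <= 4 * sdelta beta j.
  have [V [u [hV hd]]] := hb l j.
  have [g gG hg] := line_near_grid b0 (d1 l) (b2 l) hV hd ik hs.
  by exists (Ordinal (gG : (g < _.+1)%N)).
pose gf : {ffun 'I_n' -> 'I_(2 * sG beta j).+1} :=
  [ffun l => projT1 (cid (grid (lift m l)))].
exists (Ordinal (ik : (i < (sk beta j).+1)%N), gf) => p.
rewrite /box_center; case: unliftP => [l ->|->] /=.
  rewrite ptE mxE eq_sym (negbTE (neq_lift m l)) /gf ffunE.
  exact: (projT2 (cid (grid (lift m l)))).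
by rewrite ptm; lra.
Qed.

Theorem theorem2p2 (R : realType) (n : nat) (beta : R)
    (hn : (0 < n)%N) (hbeta0 : 0 < beta) (hbeta1 : beta <= 1) :
  exists S : set 'rV[R]_n,
    [/\ compact S,
        (forall w : 'rV[R]_n, unit_sphere w ->
           exists a : 'rV[R]_n, exists T : set 'rV[R]_n,
             T `<=` affine_line a w `&` S /\ hausdorff_dim T = beta%:E)
      & (hausdorff_dim S <=
           ((n%:R - 1) / 2 + (n%:R + 1) / 2 * beta)%:E)%E].
Proof.
case: n hn => // n' _; exists (furstenberg_set beta n'); split.
- exact: furstenberg_set_compact.
- by move=> w; exact: furstenberg_set_line.
have -> : (n'.+1%:R - 1) / 2 + (n'.+1%:R + 1) / 2 * beta =
    n'%:R / 2 + (n'%:R + 2) / 2 * beta by rewrite -natr1; ring.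
exact: furstenberg_set_dim.
Qed.
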